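(* Let $\delta\in(0,1)$. With probability at least $1-\delta$ over the random draw of the training set $S=(\boldsymbol{x}_1,\dots,\boldsymbol{x}_n)$, every linear classifier $f(\boldsymbol{x})=\langle\boldsymbol{w},\boldsymbol{x}\rangle$ that maximizes the $L^2$-margin $\gamma_2(\boldsymbol{w}):=\min_{i\in[n]}\frac{y_i\langle\boldsymbol{w},\boldsymbol{x}_i\rangle}{\|\boldsymbol{w}\|_2}$ on $S$ satisfies $$\mathbb{E}_{\boldsymbol{x}\sim\mathcal{D}_X}\big[\mathbb{1}[y^*(\boldsymbol{x})f(\boldsymbol{x})\le0]\big]\le4\sqrt{\frac{kd}{n}}+3\sqrt{\frac{\log(2/\delta)}{2n}}.$$
   Context: $\mathcal{D}_X$ is the uniform distribution on $\{\pm1\}^d$. $k$ is a positive odd integer. The vector $\boldsymbol{w}^*\in\mathbb{R}^d$ has its first $k$ coordinates drawn uniformly from $\{\pm1\}^k$ and all other coordinates $0$; $y^*(\boldsymbol{x})=\mathrm{sign}(\langle\boldsymbol{w}^*,\boldsymbol{x}\rangle)$. The training inputs are i.i.d. from $\mathcal{D}_X$ and $y_i=y^*(\boldsymbol{x}_i)$. *)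

(* Defs.v *)
From mathcomp Require Import all_boot all_order all_algebra.
From mathcomp Require Import boolp classical_sets reals exp.
Set Implicit Arguments. Unset Strict Implicit. Unset Printing Implicit Defensive.
Import Order.TTheory GRing.Theory Num.Theory.
Local Open Scope ring_scope.

(* A point of the hypercube {±1}^d, encoded by d booleans (true ↦ +1, false ↦ -1). *)
Definition cube (d : nat) := {ffun 'I_d -> bool}.

Definition pm1 {R : realType} (b : bool) : R := if b then 1 else -1.

Definition dotc {R : realType} (d : nat) (w : 'rV[R]_d) (x : cube d) : R :=
  \sum_(i < d) w 0 i * pm1 (x i).

Definition norm2 {R : realType} (d : nat) (w : 'rV[R]_d) : R :=
  Num.sqrt (\sum_(i < d) w 0 i ^+ 2).

Definition wstar_ok {R : realType} (d k : nat) (ws : 'rV[R]_d) : Prop :=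
  forall i : 'I_d, ((i < k)%N -> ws 0 i = 1 \/ ws 0 i = -1)
                   /\ ((k <= i)%N -> ws 0 i = 0).

Definition ystar {R : realType} (d : nat) (ws : 'rV[R]_d) (x : cube d) : R :=
  Num.sg (dotc ws x).

(* minimum of a nonempty finite list of reals (0 on the empty list, never used
   since n > 0) *)
Definition minl {R : realType} (s : seq R) : R :=
  match s with [::] => 0 | a :: t => foldr Num.min a t end.

Definition margin2 {R : realType} (d n : nat) (ws : 'rV[R]_d)
    (S : {ffun 'I_n -> cube d}) (w : 'rV[R]_d) : R :=
  minl [seq ystar ws (S i) * dotc w (S i) / norm2 w | i <- enum 'I_n].

Definition max_margin {R : realType} (d n : nat) (ws : 'rV[R]_d)
    (S : {ffun 'I_n -> cube d}) (w : 'rV[R]_d) : Prop :=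
  w != 0 /\ forall w' : 'rV[R]_d, w' != 0 -> margin2 ws S w' <= margin2 ws S w.

Definition test_err {R : realType} (d : nat) (ws w : 'rV[R]_d) : R :=
  #|[set x : cube d | ystar ws x * dotc w x <= 0]|%:R / (2 ^ d)%:R.

Definition prob_S {R : realType} (d n : nat) (E : {ffun 'I_n -> cube d} -> Prop) : R :=
  #|[set S : {ffun 'I_n -> cube d} | `[< E S >] ]|%:R / (2 ^ (d * n))%:R.

(* Main.v *)
(** Since [k] is odd, [|<w*, x>| >= 1] on the cube, so [w*] has margin at least
    [1 / sqrt k] and a maximizer rescales to [v] with [|v|^2 = k] and
    [y_i <v, x_i> >= 1] for all [i]: its ramp loss vanishes on the sample, while
    its expected ramp loss dominates the test error. Choosing one bad [v] for
    each bad sample leaves a finite class. Let [F S] be the maximum over the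
    class of the sum over [i] of (expected loss - loss at [x_i]). Resampling one
    coordinate at a time gives a McDiarmid bound
    [E exp (l (F - E F)) <= exp (n l^2)] for [0 <= l <= 1/2], and, by
    symmetrization and contraction,
    [E F <= E max_v 2 <v, sum_i x_i> <= 2 sqrt (k d n)]. Markov's inequality with
    [l = t / 2] concludes when the deviation term [t] is below [1]; otherwise the
    bound exceeds [1]. *)
Require Import Defs.
From mathcomp Require Import all_boot all_order all_algebra.
From mathcomp Require Import boolp classical_sets reals exp.
From mathcomp Require Import sequences.
From mathcomp Require Import ring lra.
Import Order.TTheory GRing.Theory Num.Theory.
Local Open Scope ring_scope.
Set Implicit Arguments. Unset Strict Implicit.

(** * Uniform averages over a finite type *)

Definition mean {R : realType} {T : finType} (f : T -> R) : R :=
  (\sum_x f x) / #|T|%:R.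

Section Mean.
Context {R : realType} {T : finType} (T0 : (0 < #|T|)%N).
Implicit Types f g : T -> R.

Let cT0 : 0 < #|T|%:R :> R. Proof. by rewrite ltr0n. Qed.

Lemma ler_mean f g : (forall x, f x <= g x) -> mean f <= mean g.
Proof.
by move=> fg; rewrite ler_wpM2r ?invr_ge0 ?ler0n//; apply: ler_sum => x _.
Qed.

Lemma eq_mean f g : f =1 g -> mean f = mean g.
Proof. by move=> fg; congr (_ / _); apply: eq_bigr => x _. Qed.

Lemma meanD f g : mean (fun x => f x + g x) = mean f + mean g.
Proof. by rewrite /mean big_split mulrDl. Qed.

Lemma meanZ c f : mean (fun x => c * f x) = c * mean f.
Proof. by rewrite /mean -big_distrr mulrA. Qed.

Lemma mean_cst (c : R) : mean (fun _ : T => c) = c.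
Proof. by rewrite /mean sumr_const -[c in LHS]mulr1 -mulrnAr mulfK// gt_eqF. Qed.

Lemma mean_sum (J : finType) (F : J -> T -> R) :
  mean (fun x => \sum_j F j x) = \sum_j mean (F j).
Proof. by rewrite /mean exchange_big big_distrl. Qed.

Lemma mean_involutive (h : T -> T) f :
  involutive h -> mean (fun x => f (h x)) = mean f.
Proof.
by move=> hK; congr (_ / _); rewrite [RHS](reindex_inj (inv_inj hK)).
Qed.

Lemma norm_mean_le f (c : R) : (forall x, `|f x| <= c) -> `|mean f| <= c.
Proof.
move=> fc; rewrite ler_norml; apply/andP; split.
  rewrite -[leLHS]mean_cst; apply: ler_mean => x.
  by have := fc x; rewrite ler_norml => /andP[].
rewrite -[leRHS]mean_cst; apply: ler_mean => x.
by have := fc x; rewrite ler_norml => /andP[].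
Qed.

End Mean.

Lemma exchange_mean {R : realType} {T U : finType} (F : T -> U -> R) :
  mean (fun x => mean (F x)) = mean (fun y => mean (F^~ y)).
Proof.
rewrite /mean -!big_distrl exchange_big /= -!mulrA [X in _ * X]mulrC //.
Qed.

(** * Maxima of finite families, and contraction in one coordinate *)

Section Fmax.
Context {R : realType} {I : finType} (i0 : I).
Implicit Types f : I -> R.

Definition fmax f : R := f [arg max_(i > i0) f i]%O.

Lemma fmax_ge f i : f i <= fmax f.
Proof. by rewrite /fmax; case: arg_maxP => // j _; apply. Qed.

Lemma fmax_le f c : (forall i, f i <= c) -> fmax f <= c.
Proof. exact. Qed.

Lemma fmax_attained f : exists i, fmax f = f i.
Proof. by eexists. Qed.

Lemma eq_fmax f g : f =1 g -> fmax f = fmax g.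
Proof.
move=> fg; apply/le_anti; rewrite !fmax_le// => i.
  by rewrite -fg fmax_ge.
by rewrite fg fmax_ge.
Qed.

End Fmax.

(* Symmetrization and Talagrand's contraction for a single coordinate: the
   sign symmetry [neg] of [T] plays the role of the Rademacher variable. *)
Lemma mean_fmax_contraction {R : realType} {T I : finType} (i0 : I)
    (neg : T -> T) (a l : I -> T -> R) (A : I -> R) :
  (0 < #|T|)%N -> involutive neg ->
  (forall v x, a v (neg x) = - a v x) ->
  (forall u v x, `|l u x - l v x| <= `|a u x - a v x|) ->
  mean (fun x => fmax i0 (fun v => A v + (mean (l v) - l v x))) <=
  mean (fun x => fmax i0 (fun v => A v + 2 * a v x)).
Proof.
move=> T0 negK aN la.
pose P x := fmax i0 (fun v => A v + 2 * l v x).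
pose M x := fmax i0 (fun v => A v - 2 * l v x).
pose N x := fmax i0 (fun v => A v + 2 * a v x).
(* For maximizers [u] of [P x] and [v] of [M x], the loss difference is at most [|a u x - a v x|].
   Either sign is covered by [N x + N (neg x)]: [u] is tested at one of [x], [neg x] and [v] at the
   other. *)
have PM x : P x + M x <= N x + N (neg x).
  have [u Pu] := fmax_attained i0 (fun v => A v + 2 * l v x).
  have [v Mv] := fmax_attained i0 (fun v => A v - 2 * l v x).
  have h1 := fmax_ge i0 (fun v => A v + 2 * a v x) u.
  have h2 := fmax_ge i0 (fun v => A v + 2 * a v x) v.
  have h3 := fmax_ge i0 (fun v => A v + 2 * a v (neg x)) u.
  have h4 := fmax_ge i0 (fun v => A v + 2 * a v (neg x)) v.
  rewrite /= !aN in h3 h4; rewrite /P /M /N Pu Mv /=.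
  have := le_trans (ler_norm _) (la u v x).
  by case: (ger0P (a u x - a v x)) => _; lra.
(* Symmetrization with a ghost point [x']: splitting [A v] into halves separates the terms in [x']
   and [x], and each half is bounded by its own maximum. *)
apply: (@le_trans _ _ (mean (fun x => mean (fun x' => 2^-1 * P x' + 2^-1 * M x)))).
  apply: ler_mean => x; apply: fmax_le => v.
  have -> : A v + (mean (l v) - l v x) =
      mean (fun x' => (A v - l v x) + l v x').
    by rewrite meanD mean_cst//; ring.
  apply: ler_mean => x'.
  have := fmax_ge i0 (fun v => A v + 2 * l v x') v.
  have := fmax_ge i0 (fun v => A v - 2 * l v x) v.
  by rewrite /= -/(P x') -/(M x); lra.
under eq_mean do rewrite meanD mean_cst// meanZ.
rewrite meanD mean_cst// meanZ.
have : mean (fun x => P x + M x) <= mean (fun x => N x + N (neg x)).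
  exact: ler_mean.
rewrite (meanD P M) (meanD N (fun x => N (neg x))) (mean_involutive N negK).
by lra.
Qed.

(** * Exponential moments of a function of bounded oscillation *)

(** The fourth power of [1 - x / 4 <= expR (- (x / 4))] bounds [expR (- x)] below by a polynomial,
    leaving a polynomial inequality on [[-1/2, 1/2]]. *)
Lemma expR_le_quadratic {R : realType} (x : R) : `|x| <= 2^-1 -> expR x <= 1 + x + x ^+ 2.
Proof.
rewrite ler_norml => /andP[x1 x2].
have : (1 - x / 4) ^+ 4 <= expR (- x).
  rewrite (_ : - x = 4%:R * - (x / 4)); last by field.
  rewrite expRM_natl; apply: lerXn2r; rewrite ?nnegrE ?expR_ge0//; first lra.
  exact: expR_ge1Dx.
move=> h.
have h2 : 1 <= (1 + x + x ^+ 2) * (1 - x / 4) ^+ 4.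
  rewrite -subr_ge0.
  have -> : (1 + x + x ^+ 2) * (1 - x / 4) ^+ 4 - 1 =
     x ^+ 2 * (3 / 8 - 11 / 16 * x + 81 / 256 * x ^+ 2 - 15 / 256 * x ^+ 3
               + x ^+ 4 / 256).
    by field.
  by rewrite mulr_ge0 ?sqr_ge0//; nra.
have p0 : 0 <= 1 + x + x ^+ 2 by nra.
have : 1 <= (1 + x + x ^+ 2) * expR (- x).
  by apply: (le_trans h2); rewrite ler_wpM2l.
by rewrite expRN ler_pdivlMr ?expR_gt0// mul1r.
Qed.

(** Values of [g] lie within 1 of their mean, so the quadratic bound applies to [lam * (g x - mu)];
    its linear term averages to 0, and [1 + lam ^+ 2 <= expR (lam ^+ 2)]. *)
Lemma mean_expR_le {R : realType} {T : finType} (g : T -> R) (lam : R) :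
  (0 < #|T|)%N -> 0 <= lam <= 2^-1 ->
  (forall x y, `|g x - g y| <= 1) ->
  mean (fun x => expR (lam * g x)) <= expR (lam * mean g) * expR (lam ^+ 2).
Proof.
move=> T0 /andP[l0 l1] gg; set mu := mean g.
have gm x : `|g x - mu| <= 1.
  have -> : g x - mu = mean (fun y => g x - g y).
    rewrite meanD mean_cst//; congr (_ + _).
    by rewrite -mulN1r -meanZ; apply: eq_mean => y; rewrite mulN1r.
  by apply: norm_mean_le.
have -> : mean (fun x => expR (lam * g x)) =
    expR (lam * mu) * mean (fun x => expR (lam * (g x - mu))).
  rewrite -meanZ; apply: eq_mean => x; rewrite -expRD; congr expR; ring.
rewrite ler_pM2l ?expR_gt0//.
apply: (@le_trans _ _ (mean (fun x => (1 + lam ^+ 2 - lam * mu) + lam * g x))).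
  apply: ler_mean => x.
  have := gm x; rewrite ler_norml => /andP[b1 b2].
  apply: le_trans (expR_le_quadratic _) _.
    by rewrite ler_norml; apply/andP; split; nra.
  have : lam ^+ 2 * (g x - mu) ^+ 2 <= lam ^+ 2.
    by rewrite ler_piMr ?sqr_ge0//; nra.
  by rewrite -exprMn; lra.
rewrite meanD mean_cst// meanZ -/mu addrNK.
exact: expR_ge1Dx.
Qed.

(** * Resampling one coordinate: McDiarmid's inequality and contraction for sums *)

Section Resample.
Context {R : realType} {T : finType} (n : nat) (T0 : (0 < #|T|)%N).
Local Notation sample := {ffun 'I_n -> T}.
Implicit Types (S : sample) (f g : sample -> R).

Definition upd S (i : 'I_n) (x : T) : sample :=
  [ffun j => if j == i then x else S j].

Lemma card_sample_gt0 : (0 < #|{: sample}|)%N.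
Proof. by rewrite card_ffun expn_gt0 T0. Qed.

(** Swapping the fresh point with coordinate [i] of the sample is an involution on pairs, hence
    preserves the uniform average. *)
Lemma mean_upd i f : mean (fun S => mean (fun x => f (upd S i x))) = mean f.
Proof.
pose h (p : sample * T) := (upd p.1 i p.2, p.1 i).
have hK : involutive h.
  move=> [S x]; rewrite /h /=; congr pair; last by rewrite ffunE eqxx.
  by apply/ffunP => j; rewrite !ffunE; case: eqP => [->|].
rewrite /mean -big_distrl /= pair_big /=.
have -> : \sum_(p : sample * T) f (upd p.1 i p.2) =
          \sum_(p : sample * T) f p.1.
  by rewrite [RHS](reindex_inj (inv_inj hK)).
rewrite -(pair_big xpredT xpredT (fun S (_ : T) => f S)) /=.
under eq_bigr do rewrite sumr_const.
rewrite sumrMnl -[X in X / _ / _]mulr_natr; congr (_ / _).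
by rewrite mulfK// pnatr_eq0 -lt0n.
Qed.

(** Reduces a comparison of means to one with all coordinates but [i] frozen. *)
Lemma ler_mean_resample i f g :
  (forall S, mean (fun x => f (upd S i x)) <= mean (fun x => g (upd S i x))) ->
  mean f <= mean g.
Proof. by move=> fg; rewrite -(mean_upd i f) -(mean_upd i g) ler_mean. Qed.

(** Averaged over [S'], [f (splice m S' S)] is the conditional expectation of [f] given the
    coordinates of [S] from [m] on: a Doob martingale. *)
Definition splice (m : nat) S' S : sample :=
  [ffun i : 'I_n => if (i < m)%N then S' i else S i].

Definition bounded_diff1 f := forall S i x, `|f (upd S i x) - f S| <= 1.

Lemma splice_upd_lt m S' S (i : 'I_n) x : (i < m)%N ->
  splice m S' (upd S i x) = splice m S' S.
Proof.
move=> im; apply/ffunP => j; rewrite !ffunE; case: ifPn => // /negP jm.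
by case: eqP => // ji; case: jm; rewrite ji.
Qed.

Lemma splice_upd_ge m S' S (i : 'I_n) x : (m <= i)%N ->
  splice m S' (upd S i x) = upd (splice m S' S) i x.
Proof.
move=> mi; apply/ffunP => j; rewrite !ffunE.
by case: (eqVneq j i) => [->|//]; rewrite ltnNge mi.
Qed.

(** The tower property of that martingale: the fresh point at coordinate [m] takes over the role of
    [S' m]. *)
Lemma mean_splice_upd (m : 'I_n) f S :
  mean (fun x => mean (fun S' => f (splice m S' (upd S m x)))) =
  mean (fun S' => f (splice m.+1 S' S)).
Proof.
rewrite exchange_mean -(mean_upd m (fun S' => f (splice m.+1 S' S))).
apply: eq_mean => S'; apply: eq_mean => x; congr f.
apply/ffunP => j; rewrite !ffunE ltnS.
case: (eqVneq j m) => [->|jm]; first by rewrite ltnn leqnn.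
by rewrite ltn_neqAle val_eqE jm.
Qed.

(** The conditional means [g m] lead from [f] at [m = 0] to the constant [mean f] at [m = n];
    averaging out each coordinate costs one factor [expR (lam ^+ 2)] by [mean_expR_le]. *)
Lemma mcdiarmid f (lam : R) : 0 <= lam <= 2^-1 -> bounded_diff1 f ->
  mean (fun S => expR (lam * f S)) <= expR (lam * mean f) * expR (lam ^+ 2) ^+ n.
Proof.
move=> lamP fb.
pose g m S := mean (fun S' => f (splice m S' S)).
have gb m S i x y : `|g m (upd S i x) - g m (upd S i y)| <= 1.
  rewrite /g.
  have -> : mean (fun S' => f (splice m S' (upd S i x))) -
            mean (fun S' => f (splice m S' (upd S i y))) =
    mean (fun S' => f (splice m S' (upd S i x)) - f (splice m S' (upd S i y))).
    rewrite meanD; congr (_ + _); rewrite -mulN1r -meanZ.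
    by apply: eq_mean => S'; rewrite mulN1r.
  apply: norm_mean_le; first exact: card_sample_gt0.
  move=> S'; case: (ltnP i m) => im.
    by rewrite !splice_upd_lt// subrr normr0.
  rewrite !splice_upd_ge//; set S1 := splice _ _ _.
  have -> : upd S1 i x = upd (upd S1 i y) i x.
    by apply/ffunP => j; rewrite !ffunE; case: eqP.
  exact: fb.
have main m : (m <= n)%N -> mean (fun S => expR (lam * f S)) <=
    mean (fun S => expR (lam * g m S)) * expR (lam ^+ 2) ^+ m.
  elim: m => [_|m IH mn].
    rewrite expr0 mulr1; apply: ler_mean => S; rewrite /g.
    under eq_mean => S'.
      have -> : splice 0 S' S = S by apply/ffunP => j; rewrite !ffunE.
      over.
    by rewrite mean_cst// card_sample_gt0.
  apply: le_trans (IH (ltnW mn)) _.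
  rewrite [_ ^+ m.+1]exprS mulrA ler_wpM2r ?exprn_ge0 ?expR_ge0//.
  rewrite mulrC -meanZ.
  apply: (@ler_mean_resample (Ordinal mn)) => S.
  apply: le_trans (mean_expR_le T0 lamP _) _; first exact: gb.
  rewrite (mean_splice_upd (Ordinal mn)) /= -/(g m.+1 S).
  under [leRHS]eq_mean => x.
    have -> : g m.+1 (upd S (Ordinal mn) x) = g m.+1 S.
      by apply: eq_mean => S'; rewrite splice_upd_lt.
    over.
  by rewrite mean_cst// mulrC.
apply: le_trans (main n (leqnn n)) _.
rewrite ler_wpM2r ?exprn_ge0 ?expR_ge0//.
have gn S : g n S = mean f.
  by apply: eq_mean => S'; congr f; apply/ffunP => j; rewrite !ffunE ltn_ord.
by under eq_mean do rewrite gn; rewrite mean_cst// card_sample_gt0.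
Qed.

(** A hybrid argument: [b m] has its first [m] summands already contracted, and each step applies
    the one-coordinate lemma with the other summands frozen in [A]. *)
Lemma mean_fmax_sum_contraction {I : finType} (i0 : I)
    (neg : T -> T) (a l : I -> T -> R) :
  involutive neg ->
  (forall v x, a v (neg x) = - a v x) ->
  (forall u v x, `|l u x - l v x| <= `|a u x - a v x|) ->
  mean (fun S => fmax i0 (fun v => \sum_i (mean (l v) - l v (S i)))) <=
  mean (fun S => fmax i0 (fun v => \sum_i 2 * a v (S i))).
Proof.
move=> negK aN la.
pose b m v S (i : 'I_n) := if (i < m)%N then 2 * a v (S i)
                           else mean (l v) - l v (S i).
suff main m : (m <= n)%N ->
    mean (fun S => fmax i0 (fun v => \sum_i (mean (l v) - l v (S i)))) <=
    mean (fun S => fmax i0 (fun v => \sum_i b m v S i)).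
  apply: le_trans (main n (leqnn n)) _; apply: ler_mean => S.
  rewrite le_eqVlt; apply/orP; left; apply/eqP; apply: eq_fmax => v.
  by apply: eq_bigr => i _; rewrite /b ltn_ord.
elim: m => [_|m IH mn].
  apply: ler_mean => S; rewrite le_eqVlt; apply/orP; left; apply/eqP.
  by apply: eq_fmax => v; apply: eq_bigr.
apply: le_trans (IH (ltnW mn)) _.
pose j := Ordinal mn; apply: (@ler_mean_resample j) => S.
pose A v := \sum_(i | i != j) b m v S i.
have sumb m' x v : (forall i : 'I_n, i != j -> (i < m')%N = (i < m)%N) ->
   \sum_i b m' v (upd S j x) i = A v + b m' v (upd S j x) j.
  move=> mm; rewrite (bigD1 j)//= addrC; congr (_ + _).
  apply: eq_bigr => i ij; rewrite /b ffunE (negbTE ij) mm//.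
have -> : mean (fun x => fmax i0 (fun v => \sum_i b m v (upd S j x) i)) =
    mean (fun x => fmax i0 (fun v => A v + (mean (l v) - l v x))).
  apply: eq_mean => x; apply: eq_fmax => v.
  by rewrite sumb// /b ltnn ffunE eqxx.
have -> : mean (fun x => fmax i0 (fun v => \sum_i b m.+1 v (upd S j x) i)) =
    mean (fun x => fmax i0 (fun v => A v + 2 * a v x)).
  apply: eq_mean => x; apply: eq_fmax => v.
  rewrite sumb /b ?ltnSn ?ffunE ?eqxx// => i ij.
  by rewrite ltnS leq_eqVlt -[m]/(val j) val_eqE (negbTE ij).
exact: (mean_fmax_contraction i0 A T0 negK aN la).
Qed.

End Resample.

(** * The ramp loss *)

Section Ramp.
Context {R : realType}.
Implicit Types z : R.

Definition ramp z : R := Num.max 0 (Num.min 1 (1 - z)).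

Lemma rampP z : [\/ z <= 0 /\ ramp z = 1, [/\ 0 <= z, z <= 1 & ramp z = 1 - z]
                 | 1 <= z /\ ramp z = 0].
Proof.
rewrite /ramp; case: (leP 1 (1 - z)) => h1.
  by rewrite max_r ?ler01//; apply: Or31; split; first lra.
case: (leP 0 (1 - z)) => h2; first by apply: Or32; split; lra.
by apply: Or33; split; first lra.
Qed.

Lemma ramp_itv z : 0 <= ramp z <= 1.
Proof. by case: (rampP z) => [[h ->]|[h h' ->]|[h ->]]; lra. Qed.

Lemma ramp_eq1 z : z <= 0 -> ramp z = 1.
Proof. by move=> z0; case: (rampP z) => [[h ->]|[h h' ->]|[h ->]]; lra. Qed.

Lemma ramp_eq0 z : 1 <= z -> ramp z = 0.
Proof. by move=> z1; case: (rampP z) => [[h ->]|[h h' ->]|[h ->]]; lra. Qed.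

Lemma ramp_lipschitz z z' : `|ramp z - ramp z'| <= `|z - z'|.
Proof.
by case: (rampP z) => [[h ->]|[h h' ->]|[h ->]];
  case: (rampP z') => [[g ->]|[g g' ->]|[g ->]];
  case: (ger0P (z - z')) => e; rewrite ler_norml; apply/andP; split; lra.
Qed.

End Ramp.

Lemma mean_bool {R : realType} {T : finType} (P : pred T) :
  mean (fun x => (P x)%:R) = #|[set x | P x]|%:R / #|T|%:R :> R.
Proof.
rewrite /mean -sum1_card natr_sum [in RHS]big_mkcond /=; congr (_ / _).
by apply: eq_bigr => x _; rewrite inE; case: (P x).
Qed.

(** * Signs on the hypercube and the complexity of bounded linear functionals *)

Section Cube.
Context {R : realType} (d : nat).
Implicit Types (x : cube d) (w : 'rV[R]_d).

Definition negc x : cube d := [ffun i => ~~ x i].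

Lemma negcK : involutive negc.
Proof. by move=> x; apply/ffunP => i; rewrite !ffunE negbK. Qed.

Lemma pm1N b : pm1 (~~ b) = - pm1 b :> R.
Proof. by case: b; rewrite /= ?opprK. Qed.

Lemma pm1_sqr b : pm1 b * pm1 b = 1 :> R.
Proof. by case: b => /=; ring. Qed.

Lemma dotc_negc w x : dotc w (negc x) = - dotc w x.
Proof.
rewrite /dotc -sumrN; apply: eq_bigr => i _.
by rewrite ffunE pm1N mulrN.
Qed.

Lemma dotcZ c w x : dotc (c *: w) x = c * dotc w x.
Proof.
by rewrite /dotc big_distrr; apply: eq_bigr => i _ /=; rewrite mxE mulrA.
Qed.

Lemma card_cube : #|{: cube d}| = (2 ^ d)%N.
Proof. by rewrite card_ffun card_bool card_ord. Qed.

Lemma card_cube_gt0 : (0 < #|{: cube d}|)%N.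
Proof. by rewrite card_cube expn_gt0. Qed.

(** In the expanded square the diagonal terms are 1; an off-diagonal product changes sign when the
    point [S i] is negated, so its mean vanishes. *)
Lemma mean_coord_sum_sqr n (j : 'I_d) :
  mean (fun S : {ffun 'I_n -> cube d} => (\sum_i pm1 (S i j)) ^+ 2) = n%:R :> R.
Proof.
have S0 := card_sample_gt0 n card_cube_gt0.
under eq_mean do rewrite expr2 big_distrlr.
rewrite mean_sum /=.
have -> : n%:R = \sum_(i < n) 1 :> R by rewrite sumr_const card_ord.
apply: eq_bigr => i _; rewrite mean_sum (bigD1 i)//= big1 ?addr0.
  by under eq_mean do rewrite pm1_sqr; rewrite mean_cst.
move=> i' ii'.
pose h (S : {ffun 'I_n -> cube d}) := upd S i (negc (S i)).
have hK : involutive h.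
  move=> S; apply/ffunP => l; rewrite !ffunE eqxx.
  by case: eqP => [->|//]; rewrite negcK.
set f := fun S : {ffun 'I_n -> cube d} => _.
have : mean f = - mean f.
  rewrite -[LHS](mean_involutive f hK) -mulN1r -meanZ; apply: eq_mean => S.
  by rewrite /f /h !ffunE eqxx (negbTE ii') ffunE pm1N mulN1r mulNr.
by lra.
Qed.

(* Weighted AM-GM in each coordinate replaces Cauchy-Schwarz and Jensen. *)
Lemma mean_fmax_dotc n (I : finType) (i0 : I) (v : I -> 'rV[R]_d) (c K : R) :
  0 < c -> (forall u, \sum_j v u 0 j ^+ 2 <= K) ->
  mean (fun S : {ffun 'I_n -> cube d} =>
    fmax i0 (fun u => \sum_i 2 * dotc (v u) (S i))) <= c * K + n%:R * d%:R / c.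
Proof.
move=> c0 vK; have S0 := card_sample_gt0 n card_cube_gt0.
apply: (@le_trans _ _ (mean (fun S : {ffun 'I_n -> cube d} =>
    c * K + \sum_j c^-1 * (\sum_i pm1 (S i j)) ^+ 2))); last first.
  rewrite meanD mean_cst// mean_sum lerD2l.
  under eq_bigr do rewrite meanZ mean_coord_sum_sqr.
  rewrite sumr_const card_ord -[_ *+ d]mulr_natr.
  by rewrite le_eqVlt; apply/orP; left; apply/eqP; ring.
apply: ler_mean => S; apply: fmax_le => u.
have -> : \sum_i 2 * dotc (v u) (S i) =
    \sum_j 2 * v u 0 j * (\sum_i pm1 (S i j)).
  rewrite /dotc; under eq_bigr do rewrite big_distrr.
  rewrite exchange_big; apply: eq_bigr => j _.
  by rewrite big_distrr; apply: eq_bigr => i _ /=; rewrite mulrA.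
apply: (@le_trans _ _ (c * \sum_j v u 0 j ^+ 2 +
    \sum_j c^-1 * (\sum_i pm1 (S i j)) ^+ 2)); last first.
  by rewrite lerD2r ler_wpM2l// ltW.
rewrite big_distrr -big_split; apply: ler_sum => j _ /=.
set a := v u 0 j; set z := \sum_i _.
have : 0 <= c^-1 * (c * a - z) ^+ 2 by rewrite mulr_ge0 ?sqr_ge0// invr_ge0 ltW.
have -> : c^-1 * (c * a - z) ^+ 2 = c * a ^+ 2 + c^-1 * z ^+ 2 - 2 * a * z.
  by field; rewrite gt_eqF.
by rewrite subr_ge0.
Qed.

End Cube.

(** * Uniform deviation of the ramp loss over a finite class *)

Section Deviation.
Context {R : realType} (d n : nat) (I : finType) (i0 : I).
Variables (y : cube d -> R) (v : I -> 'rV[R]_d) (c K : R).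
Hypothesis y1 : forall x, `|y x| <= 1.
Hypothesis c0 : 0 < c.
Hypothesis vK : forall u, \sum_j v u 0 j ^+ 2 <= K.
Local Notation sample := {ffun 'I_n -> cube d}.

Definition ramp_loss u x := ramp (y x * dotc (v u) x).

(** Left unnormalized, as [n] times the worst gap between expected and empirical loss, so that
    changing one point moves it by at most 1. *)
Definition max_deviation (S : sample) :=
  fmax i0 (fun u => \sum_i (mean (ramp_loss u) - ramp_loss u (S i))).

(** Contraction applies with [negc] as the sign symmetry: [ramp] is 1-Lipschitz and [|y x| <= 1], so
    the label drops out as well. *)
Lemma mean_max_deviation : mean max_deviation <= c * K + n%:R * d%:R / c.
Proof.
apply: le_trans _ (mean_fmax_dotc n i0 c0 vK).
apply: (@mean_fmax_sum_contraction R _ n (card_cube_gt0 d) I i0 (@negc d)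
  (fun u => dotc (v u)) ramp_loss (@negcK d)).
- by move=> u x; rewrite dotc_negc.
- move=> u u' x; apply: le_trans (ramp_lipschitz _ _) _.
  by rewrite -mulrBr normrM ler_piMl.
Qed.

Lemma max_deviation_bounded_diff : bounded_diff1 max_deviation.
Proof.
have lb u x : 0 <= ramp_loss u x <= 1 by exact: ramp_itv.
have le1 (S S' : sample) (i : 'I_n) : (forall j, j != i -> S j = S' j) ->
    max_deviation S <= max_deviation S' + 1.
  move=> SS'; apply: fmax_le => u.
  pose dev u := \sum_j (mean (ramp_loss u) - ramp_loss u (S' j)).
  apply: (@le_trans _ _ (dev u + 1)); last by rewrite lerD2r (fmax_ge i0 dev).
  rewrite /dev (bigD1 i)//= [X in _ <= X + 1](bigD1 i)//=.
  rewrite (eq_bigr (fun j => mean (ramp_loss u) - ramp_loss u (S' j))); last first.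
    by move=> j ji; rewrite SS'.
  have := lb u (S i); have := lb u (S' i); lra.
move=> S i x; rewrite ler_distl; apply/andP; split.
  rewrite lerBlDr; apply: (le1 _ _ i) => j ji; by rewrite ffunE (negbTE ji).
by apply: (le1 _ _ i) => j ji; rewrite ffunE (negbTE ji).
Qed.

Lemma max_deviation_tail (t : R) : 0 <= t <= 1 ->
  mean (fun S => (c * K + n%:R * d%:R / c + n%:R * t < max_deviation S)%R%:R) <=
  expR (- (n%:R * t ^+ 2 / 4)).
Proof.
move=> /andP[t0 t1]; set B := c * K + _.
(* This [lam] minimizes the exponent [n * lam ^+ 2 - lam * n * t], and [t <= 1] keeps it within the
   range of [mcdiarmid]. *)
pose lam := t / 2.
have lamP : 0 <= lam <= 2^-1 by rewrite /lam; lra.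
have lam0 : 0 <= lam by case/andP: lamP.
apply: (@le_trans _ _ (mean (fun S =>
    expR (- (lam * (B + n%:R * t))) * expR (lam * max_deviation S)))).
  apply: ler_mean => S; case: ltP => h; last by rewrite mulr_ge0 ?expR_ge0.
  rewrite -expRD -[leLHS]expR0 ler_expR addrC subr_ge0.
  by rewrite ler_wpM2l// ltW.
rewrite meanZ.
have := mcdiarmid (card_cube_gt0 d) lamP max_deviation_bounded_diff.
rewrite -(ler_pM2l (expR_gt0 (- (lam * (B + n%:R * t))))) => /le_trans; apply.
rewrite -expRM_natl -!expRD ler_expR.
have := ler_wpM2l lam0 mean_max_deviation; rewrite -/B.
rewrite /lam; lra.
Qed.

End Deviation.

(** * Margins, the target vector and rescaled maximizers *)

Section Margin.
Context {R : realType} (d : nat).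
Implicit Types (w ws : 'rV[R]_d).

Lemma minl_le (s : seq R) a : a \in s -> minl s <= a.
Proof.
case: s => // b s /=; elim: s a => [|e s IH] a /=.
  by rewrite inE => /eqP ->.
rewrite !inE orbCA => /orP[/eqP ->|h]; first by rewrite ge_min lexx.
by rewrite ge_min IH ?orbT// inE.
Qed.

Lemma le_minl (s : seq R) c : s != [::] ->
  (forall a, a \in s -> c <= a) -> c <= minl s.
Proof.
case: s => // b s _ /=; elim: s => [|e s IH] h /=.
  by apply: h; rewrite inE.
rewrite le_min h ?IH//=; last by rewrite !inE eqxx orbT.
by move=> a; rewrite inE => ab; apply: h; rewrite !inE orbCA ab orbT.
Qed.

Lemma norm2_gt0 w : w != 0 -> 0 < norm2 w.
Proof.
move=> w0; rewrite sqrtr_gt0 lt0r sumr_ge0 ?andbT => [|i _]; last exact: sqr_ge0.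
apply: contra w0 => /eqP /psumr_eq0P h; apply/eqP/rowP => j; rewrite mxE.
by apply/eqP; rewrite -sqrf_eq0 h// => i _; rewrite sqr_ge0.
Qed.

Lemma norm2_sqr w : norm2 w ^+ 2 = \sum_i w 0 i ^+ 2.
Proof. by rewrite sqr_sqrtr// sumr_ge0// => i _; rewrite sqr_ge0. Qed.

Lemma ystar_norm_le1 ws x : `|ystar ws x| <= 1.
Proof. by rewrite /ystar; case: sgrP => _; rewrite ?normr0 ?normrN ?normr1. Qed.

Lemma card_ord_lt k : (k <= d)%N -> #|[pred i : 'I_d | (i < k)%N]| = k.
Proof.
move=> kd; rewrite -sum1_card -(big_ord_widen_cond d xpredT (fun=> 1%N) kd).
by rewrite sum1_card card_ord.
Qed.

Section Target.
Variables (k : nat) (ws : 'rV[R]_d).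
Hypotheses (kd : (k <= d)%N) (wsP : wstar_ok k ws).

Lemma wstar_norm_sqr : \sum_i ws 0 i ^+ 2 = k%:R.
Proof.
rewrite -[in RHS](card_ord_lt kd) -sum1_card natr_sum big_mkcond [RHS]big_mkcond /=.
apply: eq_bigr => i _; have [h1 h2] := wsP i; rewrite inE.
by case: ltnP => ik; [case: (h1 ik) => ->|rewrite h2//]; ring.
Qed.

(* The inner product is a sum of [k] signs, hence an odd integer. *)
Lemma wstar_dotc_ge1 x : odd k -> 1 <= `|dotc ws x|.
Proof.
move=> ok.
have [m ->] : exists m : nat, dotc ws x = k%:R - 2 * m%:R.
  (* [m] counts the coordinates below [k] where the signs of [ws] and [x] differ; each such product
     is [1 - 2]. *)
  exists (\sum_(i < d | (i < k)%N) (ws ord0 i * pm1 (x i) != 1)%R)%N.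
  have -> : k%:R = \sum_(i < d | (i < k)%N) 1 :> R.
    by rewrite sumr_const -[in LHS](card_ord_lt kd).
  rewrite natr_sum big_distrr -sumrB.
  rewrite /dotc big_mkcond [RHS]big_mkcond /=.
  apply: eq_bigr => i _; have [h1 h2] := wsP i.
  case: ltnP => ik; last by rewrite h2// mul0r.
  have m1 : (-1 : R) != 1 by rewrite lt_eqF//; lra.
  case: (h1 ik) => ->; case: (x i) => /=;
    rewrite ?mulr1 ?mul1r ?mulrNN ?mulr1 ?eqxx ?(negbTE m1) ?m1 /=; ring.
case: (ltngtP k (2 * m)) => km.
- rewrite ler0_norm.
    have : (k.+1%:R <= (2 * m)%:R :> R) by rewrite ler_nat.
    by rewrite -natr1 natrM; lra.
  have : (k.+1%:R <= (2 * m)%:R :> R) by rewrite ler_nat.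
  by rewrite -natr1 natrM; lra.
- have : ((2 * m).+1%:R <= k%:R :> R) by rewrite ler_nat.
  rewrite -natr1 natrM => h; rewrite ger0_norm; lra.
- by move: ok; rewrite km oddM.
Qed.

(** The scaling gives [w] the norm of [ws], turning a normalized margin of at least [1 / sqrt k]
    into 1; the test error is invariant under positive scaling. *)
Lemma max_margin_normalized n (S : {ffun 'I_n -> cube d}) w :
  (0 < k)%N -> odd k -> (0 < n)%N -> max_margin ws S w ->
  exists v : 'rV[R]_d, [/\ \sum_j v 0 j ^+ 2 <= k%:R,
    forall i, 1 <= ystar ws (S i) * dotc v (S i) &
    test_err ws v = test_err ws w].
Proof.
move=> k0 ok n0 [w0 wmax].
have nws : norm2 ws = Num.sqrt k%:R by rewrite /norm2 wstar_norm_sqr.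
have sk0 : 0 < Num.sqrt k%:R :> R by rewrite sqrtr_gt0 ltr0n.
have ws0 : ws != 0.
  apply/eqP => h; move: sk0; rewrite -nws h /norm2 big1 ?sqrtr0 ?ltxx// => i _.
  by rewrite mxE expr0n.
have nw0 := norm2_gt0 w0.
pose c := Num.sqrt k%:R / norm2 w.
have c0 : 0 < c by rewrite divr_gt0.
have yc x : ystar ws x * dotc (c *: w) x = c * (ystar ws x * dotc w x).
  by rewrite dotcZ mulrCA.
exists (c *: w); split.
- under eq_bigr do rewrite mxE exprMn.
  rewrite -big_distrr /= -norm2_sqr -exprMn /c divfK ?gt_eqF//.
  by rewrite sqr_sqrtr// ler0n.
- move=> i; rewrite yc.
  have mi : margin2 ws S w <= ystar ws (S i) * dotc w (S i) / norm2 w.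
    by apply: minl_le; apply/mapP; exists i => //; rewrite mem_enum.
  have mws : (Num.sqrt k%:R)^-1 <= margin2 ws S ws.
    apply: le_minl.
      by rewrite -size_eq0 size_map size_enum_ord -lt0n.
    move=> a /mapP[j _ ->].
    rewrite nws ler_peMl ?invr_ge0 ?(ltW sk0)//.
    by rewrite /ystar -normrEsg wstar_dotc_ge1.
  have := ler_wpM2l (ltW sk0) (le_trans mws (le_trans (wmax _ ws0) mi)).
  rewrite mulfV ?gt_eqF// => /le_trans; apply.
  by rewrite /c le_eqVlt; apply/orP; left; apply/eqP; ring.
- congr (_%:R / _); congr (#|pred_of_set _|).
  by apply/setP => x; rewrite !inE yc pmulr_rle0.
Qed.

End Target.

Lemma test_err_le1 ws w : test_err ws w <= 1.
Proof.
rewrite ler_pdivrMr ?ltr0n ?expn_gt0// mul1r ler_nat -card_cube.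
exact: max_card.
Qed.

Lemma test_err_le_ramp ws w :
  test_err ws w <= mean (fun x => ramp (ystar ws x * dotc w x)).
Proof.
rewrite /test_err -card_cube -mean_bool; apply: ler_mean => x.
by case: (lerP (ystar ws x * dotc w x) 0) => [/ramp_eq1 ->//|_];
  have /andP[] := ramp_itv (ystar ws x * dotc w x).
Qed.

End Margin.

(** * Assembly of the generalization bound *)

Theorem theoremE4 (R : realType) (d k n : nat) (delta : R)
    (ws : 'rV[R]_d) :
  (0 < k)%N -> odd k -> (k <= d)%N -> (0 < n)%N ->
  wstar_ok k ws ->
  0 < delta < 1 ->
  1 - delta <=
  prob_S (fun S : {ffun 'I_n -> cube d} =>
    forall w : 'rV[R]_d, max_margin ws S w ->
      test_err ws w <=
        4 * Num.sqrt ((k * d)%:R / n%:R)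
        + 3 * Num.sqrt (ln (2 / delta) / (2 * n%:R))).
Proof.
move=> k0 ok kd n0 wsP /andP[de0 de1].
set s := Num.sqrt ((k * d)%:R / n%:R); set t := 3 * Num.sqrt _.
set E := fun S => _.
have d0 : (0 < d)%N by apply: leq_trans kd.
have nR : 0 < n%:R :> R by rewrite ltr0n.
have kR : 0 < k%:R :> R by rewrite ltr0n.
have dR : 0 < d%:R :> R by rewrite ltr0n.
have s0 : 0 < s by rewrite sqrtr_gt0 divr_gt0// ltr0n muln_gt0 k0.
have s2 : s ^+ 2 = k%:R * d%:R / n%:R.
  by rewrite sqr_sqrtr ?natrM// divr_ge0 ?ler0n// mulr_ge0 ?ler0n.
have dd : 1 < 2 / delta by rewrite ltr_pdivlMr//; lra.
have ln0 : 0 < ln (2 / delta) by exact: ln_gt0.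
have t0 : 0 <= t by rewrite mulr_ge0 ?sqrtr_ge0.
have t2 : n%:R * t ^+ 2 / 4 = 9 / 8 * ln (2 / delta).
  rewrite exprMn sqr_sqrtr; first by field; rewrite gt_eqF.
  by rewrite divr_ge0 ?mulr_ge0 ?ltW.
have cardS : #|{: {ffun 'I_n -> cube d}}| = (2 ^ (d * n))%N.
  by rewrite card_ffun card_cube card_ord expnM.
have S0 := card_sample_gt0 n (card_cube_gt0 d).
have prE : prob_S E = mean (fun S => `[< E S >]%:R) :> R.
  by rewrite mean_bool cardS.
(* For [t >= 1] the bound is trivial because a test error is at most 1. *)
rewrite prE; have [t1|t1] := leP 1 t.
  have -> : mean (fun S => `[< E S >]%:R) = 1 :> R.
    under eq_mean => S.
      have -> : `[< E S >] = true.
        apply/asboolP => w _; apply: le_trans (test_err_le1 _ _) _.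
        by move: s0; lra.
      over.
    exact: mean_cst.
  by lra.
(* The class is indexed by the samples themselves: a bad sample gets its own rescaled violator, a
   good one the zero vector, which respects the norm bound. *)
have /choice[v vP] : forall S : {ffun 'I_n -> cube d}, exists v : 'rV[R]_d,
    \sum_j v 0 j ^+ 2 <= k%:R /\ (~ E S ->
      (forall i, 1 <= ystar ws (S i) * dotc v (S i)) /\
      4 * s + t < test_err ws v).
  move=> S; have [ES|nES] := pselect (E S).
    exists 0; split => //; rewrite big1 ?ler0n// => j _.
    by rewrite mxE expr0n.
  have /existsNP[w /not_implyP[wm /negP]] := nES; rewrite -ltNge => we.
  have [v [vk vm ve]] := max_margin_normalized kd wsP k0 ok n0 wm.
  by exists v; split => // _; split => //; rewrite ve.
(* This weight balances the two terms of the complexity bound, each becoming [n * s]. *)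
pose c := s * n%:R / k%:R.
have c0 : 0 < c by rewrite divr_gt0// mulr_gt0.
have cB : c * k%:R + n%:R * d%:R / c = 2 * (n%:R * s).
  have -> : n%:R * d%:R / c = n%:R * s.
    have sn : s != 0 by rewrite gt_eqF.
    rewrite /c; apply: (mulIf sn).
    rewrite -[RHS]mulrA -expr2 s2; field; rewrite !gt_eqF//.
  by rewrite /c; field; rewrite gt_eqF.
pose i0 : {ffun 'I_n -> cube d} := [ffun=> [ffun=> true]].
pose F := @max_deviation R d n _ i0 (ystar ws) v.
have tail : mean (fun S => (2 * (n%:R * s) + n%:R * t < F S)%R%:R) <= delta :> R.
  have := @max_deviation_tail R d n _ i0 (ystar ws) v c k%:R
    (ystar_norm_le1 ws) c0 (fun S => (vP S).1) t.
  rewrite cB t2 t0 ltW// => /(_ isT) /le_trans; apply.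
  (* The exponent [9 / 8 * ln (2 / delta)] is at least [ln (2 / delta)], so the tail is at most
     [delta / 2]. *)
  apply: (@le_trans _ _ (expR (- ln (2 / delta)))).
    by rewrite ler_expR; lra.
  by rewrite expRN lnK ?posrE ?(lt_trans _ dd)// invf_div; lra.
(* Every sample either satisfies [E] or has large deviation. For a bad [S], the member [v S] has
   zero loss on [S], so [F S] is at least [n] times its expected loss, which exceeds
   [n * (4 * s + t)]. *)
have : 1 <= mean (fun S => `[< E S >]%:R + (2 * (n%:R * s) + n%:R * t < F S)%R%:R) :> R.
  rewrite -[leLHS](mean_cst S0); apply: ler_mean => S.
  case: asboolP => [_|nES]; first by rewrite lerDl ler0n.
  rewrite (_ : (_ < F S) = true) ?add0r//.
  have [vm ve] := (vP S).2 nES.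
  apply: lt_le_trans (fmax_ge i0 _ S) => /=.
  rewrite (eq_bigr (fun=> mean (ramp_loss (ystar ws) v S))) => [|i _]; last first.
    by rewrite {2}/ramp_loss ramp_eq0 ?subr0.
  rewrite sumr_const card_ord -[ltRHS]mulr_natl.
  apply: (@le_lt_trans _ _ (n%:R * (4 * s + t))); last first.
    by rewrite ltr_pM2l// (lt_le_trans ve)// test_err_le_ramp.
  have : 0 < n%:R * s by rewrite mulr_gt0.
  lra.
by rewrite meanD; lra.
Qed.
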